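(* Let $X$ be a metric space, let $E$ be a Banach space, and let $1\le p<+\infty$. Suppose there is a $\delta>0$ such that for every $R>0$ and every $\varepsilon>0$ there is a map $\varphi:X\to E$ (depending on $R$ and $\varepsilon$) satisfying: (1) $\sup\{\|\varphi(x)-\varphi(y)\| : x,y\in X,\ d(x,y)\le R\}\le\varepsilon$; (2) for every $m\in\mathbb{N}$, $\sup\{\|\varphi(x)-\varphi(y)\| : x,y\in X,\ d(x,y)\le m\}<+\infty$; (3) $\lim_{s\to+\infty}\inf\{\|\varphi(x)-\varphi(y)\| : x,y\in X,\ d(x,y)\ge s\}\ge\delta$. Then $X$ admits a coarse embedding into $E^p$.
   Context: For a Banach space $E$ and $1\le p<+\infty$, $E^p=\{x=(x_i)_{i\in\mathbb{N}} : x_i\in E,\ \sum_{i\in\mathbb{N}}\|x_i\|^p<+\infty\}$ with norm $\|x\|=(\sum_{i\in\mathbb{N}}\|x_i\|^p)^{1/p}$. A map $f:X\to Y$ between metric spaces is a coarse embedding if: for every $s\ge 0$ there is $S\ge 0$ such that $d(x,x')\le s$ implies $d(f(x),f(x'))\le S$; and for every $r\ge 0$ there is $R\ge 0$ such that $d(f(x),f(x'))\le r$ implies $d(x,x')\le R$. $X$ admits a coarse embedding into $Y$ if such an $f$ exists. The infimum of the empty set is $+\infty$ by convention. *)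

(* Defs.v *)
From HB Require Import structures.
From mathcomp Require Import all_boot all_order all_algebra.
From mathcomp Require Import all_classical all_reals all_analysis.

Set Implicit Arguments.
Unset Strict Implicit.
Unset Printing Implicit Defensive.

Import Order.TTheory GRing.Theory Num.Theory.
Import numFieldNormedType.Exports.

Local Open Scope classical_set_scope.
Local Open Scope ring_scope.

Section psum.
Context {R : realType} {E : normedModType R}.
Implicit Types (p : R) (x y : nat -> E).

(* The sum of nonnegative terms is taken in \bar R, so that
   p-summability reads [psum p x < +oo]. *)
Definition psum p x : \bar R := (\sum_(i <oo) (`|x i| `^ p)%:E)%E.

Lemma psum_ge0 p x : (0 <= psum p x)%E.
Proof. by apply: nneseries_ge0 => i _ _; rewrite lee_fin powR_ge0. Qed.

Lemma psum0 p : 1 <= p -> psum p (0 : nat -> E) = 0%E.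
Proof.
move=> p1; apply: eseries0 => i _ _.
by rewrite normr0 powR0// gt_eqF// (lt_le_trans ltr01).
Qed.

Lemma psumZ p a x : psum p (a *: x) = ((`|a| `^ p)%:E * psum p x)%E.
Proof.
rewrite /psum -nneseriesZl; last by move=> i _; rewrite lee_fin powR_ge0.
by apply: eq_eseriesr => i _; rewrite normrZ powRM.
Qed.

Lemma psum_eq0 p x : psum p x = 0%E -> x = 0.
Proof.
move=> px0; apply/funext => i; apply/eqP.
have u0 k : true -> (0 <= (`|x k| `^ p)%:E)%E by rewrite lee_fin powR_ge0.
have : ((`|x i| `^ p)%:E <= 0)%E.
  rewrite -px0 /psum (nneseriesD1 u0 (n := i))// leeDl//.
  by apply: nneseries_ge0 => k _ _; exact: u0.
rewrite lee_fin => xip; have : `|x i| `^ p = 0.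
  by apply/eqP; rewrite eq_le xip powR_ge0.
by move/powR_eq0_eq0/normr0_eq0 => ->.
Qed.

Lemma psum_minkowski p x y : 1 <= p ->
  (psum p (x + y)%R `^ p^-1 <= psum p x `^ p^-1 + psum p y `^ p^-1)%E.
Proof.
move=> p1; have p0 : 0 < p by rewrite (lt_le_trans ltr01).
have psumE z : (psum p z `^ p^-1 =
    'N[counting]_p%:E [EFin \o (fun i => `|z i|)%R])%E.
  rewrite Lnorm_counting//; congr (_ `^ _)%E.
  by apply: eq_eseriesr => i _ /=; rewrite normr_id.
apply: (@le_trans _ _
    ('N[counting]_p%:E [EFin \o ((fun i => `|x i|) \+ (fun i => `|y i|))%R])%E).
  rewrite Lnorm_counting// gt0_ler_poweR//.
  - by rewrite invr_ge0 ltW.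
  - by rewrite in_itv/= leey andbT psum_ge0.
  - rewrite in_itv/= leey andbT; apply: nneseries_ge0 => i _ _.
    by rewrite lee_fin powR_ge0.
  apply: lee_nneseries => i _; first by move=> _; rewrite lee_fin powR_ge0.
  rewrite /= lee_fin ge0_ler_powR ?nnegrE ?(ltW p0)//.
  by rewrite (le_trans (ler_normD _ _))// ler_norm.
by rewrite !psumE; exact: minkowski_EFin.
Qed.

End psum.

Definition lp_pred {R : realType} (E : normedModType R) (p : R) :
    {pred nat -> E} :=
  [pred x | (psum p x < +oo)%E].
Arguments lp_pred {R} E p.

(* The space E^p; the bound 1 <= p is a parameter of the type because the
   norm below relies on it. *)
Record lp {R : realType} (E : normedModType R) (p : R) (p1 : 1 <= p) := Lp {
  lp_val :> nat -> E;
  _ : lp_val \in lp_pred E p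
}.

(* Locked: comparing two norms by unfolding is prohibitively slow. *)
HB.lock Definition lp_norm {R : realType} {E : normedModType R} {p : R}
    {p1 : 1 <= p} (x : lp E p1) : R :=
  fine (psum p x) `^ p^-1.
Canonical lp_norm_unlockable := Unlockable lp_norm.unlock.

Section lp_normed.
Context {R : realType} {E : normedModType R} {p : R} {p1 : 1 <= p}.

Lemma lp_submod_closed : submod_closed (lp_pred E p).
Proof.
have p0 : p != 0 by rewrite gt_eqF// (lt_le_trans ltr01).
split; first by rewrite inE psum0// ltry.
move=> a x y; rewrite !inE => xp yp.
apply: (@lty_poweRy _ _ p^-1); first by rewrite invr_eq0.
apply: (le_lt_trans (psum_minkowski _ _ p1)).
rewrite lte_add_pinfty ?poweR_lty// psumZ.
by rewrite lte_mul_pinfty ?lee_fin ?powR_ge0.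
Qed.

HB.instance Definition _ := GRing.isSubmodClosed.Build _ _ (lp_pred E p)
  lp_submod_closed.

HB.instance Definition _ := [isSub for @lp_val R E p p1].
HB.instance Definition _ := [Choice of lp E p1 by <:].
HB.instance Definition _ := [SubChoice_isSubLmodule of lp E p1 by <:].

Lemma lp_normE (x : lp E p1) : (lp_norm x)%:E = (psum p x `^ p^-1)%E.
Proof.
rewrite unlock -poweR_EFin fineK// ge0_fin_numE ?psum_ge0//.
exact: (valP x).
Qed.

Lemma lp_normD (x y : lp E p1) : lp_norm (x + y) <= lp_norm x + lp_norm y.
Proof.
rewrite -lee_fin EFinD !lp_normE.
exact: (psum_minkowski (val x) (val y) p1).
Qed.

Lemma lp_normZ a (x : lp E p1) : lp_norm (a *: x) = `|a| * lp_norm x.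
Proof.
have p0 : p != 0 by rewrite gt_eqF// (lt_le_trans ltr01).
apply: EFin_inj; rewrite EFinM !lp_normE (psumZ p a (val x)).
rewrite poweRM ?psum_ge0 ?lee_fin ?powR_ge0// poweR_EFin -powRrM mulfV//.
by rewrite powRr1.
Qed.

Lemma lp_norm0_eq0 (x : lp E p1) : lp_norm x = 0 -> x = 0.
Proof.
move=> x0; have := lp_normE x; rewrite x0 => /esym px0.
apply: val_inj; apply: (@psum_eq0 _ _ p).
by apply: (@poweR_eq0_eq0 _ _ p^-1); rewrite ?psum_ge0.
Qed.

HB.instance Definition _ :=
  Lmodule_isNormed.Build R (lp E p1) lp_normD lp_normZ lp_norm0_eq0.

Let lp_dist (x y : lp E p1) : R := `|x - y|.

Let lp_dist_ge0 x y : 0 <= lp_dist x y.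
Proof. exact: normr_ge0. Qed.

Let lp_dist_positivity x y : lp_dist x y = 0 -> x = y.
Proof. by move/normr0_eq0/eqP; rewrite subr_eq0 => /eqP. Qed.

Let lp_ball_dist x d : ball x d = [set y | lp_dist x y < d].
Proof. by rewrite -ball_normE. Qed.

HB.instance Definition _ := PseudoMetric_isMetric.Build R (lp E p1)
  lp_dist_ge0 lp_dist_positivity lp_ball_dist.

End lp_normed.

Definition coarse_embedding {R : realType} {X Y : metricType R} (f : X -> Y) :=
  (forall s : R, 0 <= s -> exists2 S : R, 0 <= S &
     forall x x' : X, mdist x x' <= s -> mdist (f x) (f x') <= S) /\
  (forall r : R, 0 <= r -> exists2 S : R, 0 <= S &
     forall x x' : X, mdist (f x) (f x') <= r -> mdist x x' <= S).

Definition coarsely_embeds {R : realType} (X Y : metricType R) :=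
  exists f : X -> Y, coarse_embedding f.

(* Moduli of a map into a normed space, valued in \bar R: an infimum over no
   pair is +oo; a supremum over no pair (only when X is empty or r < 0) is -oo. *)
Definition expansion {R : realType} {X : metricType R} {E : normedModType R}
    (phi : X -> E) (r : R) : \bar R :=
  ereal_sup [set `|phi z.1 - phi z.2|%:E | z in [set z | mdist z.1 z.2 <= r]].

Definition compression {R : realType} {X : metricType R} {E : normedModType R}
    (phi : X -> E) (s : R) : \bar R :=
  ereal_inf [set `|phi z.1 - phi z.2|%:E | z in [set z | mdist z.1 z.2 >= s]].

(* Main.v *)
Require Import Defs.
From mathcomp Require Import all_boot all_order all_algebra.
From mathcomp Require Import all_classical all_reals all_analysis.

Set Implicit Arguments.
Unset Strict Implicit.
Unset Printing Implicit Defensive.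

Import Order.TTheory GRing.Theory Num.Theory.
Import numFieldNormedType.Exports.

Local Open Scope classical_set_scope.
Local Open Scope ring_scope.

(** For each n apply the hypothesis at scale r = n + 1 with eps = 2 ^- n.+1 to
    get a map phi n, fix a base point x0, and let f x be the sequence of the
    phi n x - phi n x0.

    If two points are at distance at most m, then every phi n with n >= m moves
    them apart by at most 2 ^- n.+1, and the p-th powers of these numbers have
    sum at most 1, because a `^ p <= a on [0, 1] ([psum_le_head]).  Only the
    first m terms of |f x - f y|^p remain.  With y = x0 this shows that f x
    lies in E^p; with y arbitrary, finiteness of the expansion bounds these
    terms, hence |f x - f y|, in terms of the distance.

    Conversely, the limit of the compression of phi n is at least delta, so
    phi n separates by delta / 2 all points that are far enough apart
    ([lt_lim_compression]).  Points far enough apart for all of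
    phi 0, ..., phi (N - 1) satisfy |f x - f y|^p >= N (delta / 2)^p
    ([psum_ge_head]), which exceeds any given bound for N large.  The positive
    delta is the same for all n: this is what makes the N terms add up. *)

Section moduli.
Context {R : realType} {X : metricType R} {E : normedModType R}.
Implicit Types (phi : X -> E) (x y : X).

Lemma le_expansion phi r x y : mdist x y <= r ->
  (`|phi x - phi y|%:E <= expansion phi r)%E.
Proof. by move=> xyr; apply: ereal_sup_ubound; exists (x, y). Qed.

Lemma compression_le phi s x y : s <= mdist x y ->
  (compression phi s <= `|phi x - phi y|%:E)%E.
Proof. by move=> sxy; apply: ereal_inf_lbound; exists (x, y). Qed.

Lemma le_compression phi : {homo compression phi : s t / s <= t >-> (s <= t)%E}.
Proof.
move=> s t st; apply: le_ereal_inf; apply: image_subset => z /=.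
exact: le_trans.
Qed.

(** The compression is nondecreasing, so its limit exists, and a limit above c
    must be approached by values above c.  This turns the hypothesis on [lim],
    which by itself says nothing when the limit does not exist, into a
    statement about pairs of points. *)
Lemma lt_lim_compression phi c :
    (c%:E < lim (compression phi s @[s --> +oo%R]))%E ->
  exists S, forall x y, S <= mdist x y -> c < `|phi x - phi y|.
Proof.
move=> clim; have [S cS] : exists S, (c%:E < compression phi S)%E.
  apply: contrapT => noS; move: clim; rewrite ltNge => /negP; apply.
  apply: lime_le; first exact/nondecreasing_is_cvge/le_compression.
  by apply: nearW => s; rewrite leNgt; apply/negP => cs; apply: noS; exists s.
exists S => x y Sxy; rewrite -lte_fin.
exact: lt_le_trans cS (compression_le _ Sxy).
Qed.

End moduli.

Section psum_bounds.
Context {R : realType} {E : normedModType R}.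
Implicit Types (p : R) (x y : nat -> E).

(** Since p >= 1 and the tail entries are at most 1, their p-th powers are
    dominated by the entries, hence by a series of sum 1. *)
Lemma psum_le_head p N x : 1 <= p ->
    (forall i, (N <= i)%N -> `|x i| <= 1 / (2 ^ i.+1)%:R) ->
  (psum p x <= (\sum_(i < N) `|x i| `^ p + 1)%:E)%E.
Proof.
move=> p1 xN; have p0 : 0 <= p := le_trans ler01 p1.
rewrite /psum (nneseries_split 0 N); last by move=> k _; rewrite lee_fin powR_ge0.
rewrite add0n sumEFin big_mkord EFinD leeD2l//.
rewrite -nneseries_addn; last by move=> i; rewrite lee_fin powR_ge0.
apply: le_trans (epsilon_trick0 xpredT ler01).
apply: lee_nneseries => i _; first by move=> _; rewrite lee_fin powR_ge0.
have i2 : `|x (i + N)%N| <= 1 / (2 ^ i.+1)%:R.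
  apply: le_trans (xN _ (leq_addl _ _)) _.
  rewrite ler_pM2l// lef_pV2 ?posrE ?ltr0n ?expn_gt0// ler_nat leq_exp2l//.
  by rewrite ltnS leq_addr.
have half_le1 : 1 / (2 ^ i.+1)%:R <= 1 :> R.
  by rewrite ler_pdivrMr ?ltr0n ?expn_gt0// mul1r ler1n expn_gt0.
rewrite lee_fin; have [->|xi0] := eqVneq (`|x (i + N)%N|) 0.
  by rewrite powR0 ?gt_eqF ?(lt_le_trans ltr01)// divr_ge0.
apply: le_trans (i2); apply: ge1r_powR => //.
by rewrite lt_def xi0 normr_ge0 (le_trans (i2)).
Qed.

Lemma psum_ge_head p N c x : 0 <= p -> 0 <= c ->
    (forall i, (i < N)%N -> c <= `|x i|) ->
  ((N%:R * c `^ p)%:E <= psum p x)%E.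
Proof.
move=> p0 c0 cx.
have x0 i : (0 <= i)%N -> true -> (0 <= (`|x i| `^ p)%:E)%E.
  by rewrite lee_fin powR_ge0.
apply: le_trans (nneseries_lim_ge N x0).
rewrite sumEFin lee_fin big_mkord mulr_natl -[X in _ *+ X](card_ord N) -sumr_const.
by apply: ler_sum => i _; rewrite ge0_ler_powR ?nnegrE ?cx.
Qed.

End psum_bounds.

Lemma psum_lp_norm {R : realType} {E : normedModType R} {p : R} {p1 : 1 <= p}
  (x : lp E p1) : psum p x = (lp_norm x `^ p)%:E.
Proof.
have p0 : p != 0 by rewrite gt_eqF// (lt_le_trans ltr01).
by rewrite -poweR_EFin lp_normE -poweRrM mulVf// poweRe1// psum_ge0.
Qed.

(** The gluing argument for a sequence of maps, freed from the moduli.  Both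
    the scales n and the bounds 2 ^- n.+1 in the second hypothesis are
    normalised so that the tail of [psum] sums to at most 1; the constant c of
    the last one does not depend on n. *)
Lemma coarse_embedding_of_seq (R : realType) (X : metricType R)
    (E : normedModType R) (p : R) (p1 : 1 <= p) (c : R) (phi : nat -> X -> E) :
    0 < c ->
    (forall n x y, mdist x y <= n%:R ->
      `|phi n x - phi n y| <= 1 / (2 ^ n.+1)%:R) ->
    (forall n m : nat, exists C, forall x y, mdist x y <= m%:R ->
      `|phi n x - phi n y| <= C) ->
    (forall n, exists S, forall x y, S <= mdist x y ->
      c <= `|phi n x - phi n y|) ->
  coarsely_embeds X (lp E p1).
Proof.
move=> c0 small bnd far.
(* Without a base point X is empty, and any map will do. *)
have [[x0]|X0] := pselect (inhabited X); last first.
  exists (fun _ => 0); split => r _; exists 0 => // x;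
    by exfalso; apply: X0; constructor.
have pp : 0 < p := lt_le_trans ltr01 p1.
have lpf x : (fun n => phi n x - phi n x0) \in lp_pred E p.
  rewrite inE; apply: le_lt_trans (ltry _).
  apply: (@psum_le_head _ _ p (Num.trunc (mdist x x0)).+1 _ p1) => n.
  move=> xn; apply: small; apply: ltW; rewrite -truncn_lt_nat//.
  exact: mdist_ge0.
pose f x : lp E p1 := Lp p1 (lpf x).
(* The base point cancels in differences. *)
have fE x y : psum p (lp_val (f x - f y)) = psum p (fun n => phi n x - phi n y).
  congr psum; apply/funext => n.
  transitivity ((phi n x - phi n x0) - (phi n y - phi n x0)); first by [].
  by rewrite opprB addrA subrK.
exists f; split => r r0.
- pose m := (Num.trunc r).+1.
  have rm : r <= m%:R by apply: ltW; rewrite -truncn_lt_nat.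
  have [C CP] := choice (fun n => bnd n m).
  exists ((\sum_(i < m) `|C i| `^ p + 1) `^ p^-1) => [|x y xy].
    exact: powR_ge0.
  have xym := le_trans xy rm.
  rewrite -[mdist (f x) _]/(lp_norm (f x - f y)).
  have fxy0 : 0 <= lp_norm (f x - f y) := normr_ge0 (f x - f y).
  rewrite -[leLHS]powRr1// -[X in _ `^ X <= _](mulfV (lt0r_neq0 pp)) powRrM.
  rewrite ge0_ler_powR ?invr_ge0 ?(ltW pp)// ?nnegrE ?powR_ge0//.
    by rewrite addr_ge0// sumr_ge0// => i _; exact: powR_ge0.
  rewrite -lee_fin -psum_lp_norm fE.
  have tail i : (m <= i)%N -> `|phi i x - phi i y| <= 1 / (2 ^ i.+1)%:R.
    by move=> mi; apply/small/(le_trans xym); rewrite ler_nat.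
  apply: le_trans (psum_le_head p1 tail) _.
  rewrite lee_fin lerD2r; apply: ler_sum => i _.
  rewrite ge0_ler_powR ?nnegrE ?(ltW pp)// (le_trans (CP i _ _ xym))//.
  exact: ler_norm.
- have [S SP] := choice far.
  (* Enough terms of size c `^ p to exceed r `^ p. *)
  pose N := (Num.trunc (r `^ p / c `^ p)).+1.
  have rN : r `^ p < N%:R * c `^ p.
    by rewrite -ltr_pdivrMr ?powR_gt0// -truncn_lt_nat// divr_ge0 ?powR_ge0.
  exists (\big[Num.max/0]_(i < N) S i) => [|x y]; first exact: bigmax_ge_id.
  rewrite -[mdist (f x) _]/(lp_norm (f x - f y)) => fxy.
  rewrite leNgt; apply/negP => xyS.
  have fxyp : lp_norm (f x - f y) `^ p <= r `^ p.
    by rewrite ge0_ler_powR ?nnegrE ?(ltW pp)//; exact: (normr_ge0 (f x - f y)).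
  have := le_lt_trans fxyp rN; rewrite ltNge => /negP; apply.
  rewrite -lee_fin -psum_lp_norm fE.
  apply: psum_ge_head => [||i iN]; [exact: ltW|exact: ltW|].
  apply: SP; apply: le_trans (ltW xyS).
  exact: (@le_bigmax _ _ _ 0 (fun i : 'I_N => S i) (Ordinal iN)).
Qed.

Theorem theorem1p1 (R : realType) (X : metricType R)
    (E : completeNormedModType R) (p : R) (p1 : 1 <= p)
    (hX : exists2 delta : R, 0 < delta &
      forall r eps : R, 0 < r -> 0 < eps ->
      exists phi : X -> E,
        [/\ (expansion phi r <= eps%:E)%E,
            forall m : nat, (expansion phi m%:R < +oo)%E &
            (delta%:E <= lim (compression phi s @[s --> +oo%R]))%E]) :
  coarsely_embeds X (lp E p1).
Proof.
have [delta delta0 phiP] := hX.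
have eps_gt0 n : 0 < 1 / (2 ^ n.+1)%:R :> R.
  by rewrite divr_gt0// ltr0n expn_gt0.
have /choice[phi phi_n] n := phiP n.+1%:R _ (ltr0Sn _ n) (eps_gt0 n).
apply: (@coarse_embedding_of_seq _ _ _ _ p1 (delta / 2) phi) => [|n x y xy|n m|n].
- by rewrite divr_gt0.
- have [phin _ _] := phi_n n; rewrite -lee_fin; apply: le_trans phin.
  by apply: le_expansion; rewrite (le_trans xy)// ler_nat.
- have [_ /(_ m) phin _] := phi_n n.
  exists (fine (expansion (phi n) m%:R)) => x y /(le_expansion (phi n)) xym.
  rewrite -lee_fin fineK// fin_numElt phin andbT.
  exact: lt_le_trans (ltNyr _) xym.
- have [_ _ phin] := phi_n n.
  have [|S SP] := @lt_lim_compression _ _ _ (phi n) (delta / 2).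
    by apply: lt_le_trans phin; rewrite lte_fin ltr_pdivrMr// ltr_pMr// ltr1n.
  by exists S => x y /SP/ltW.
Qed.
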